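(* Let $p$ be a prime number that does not divide $n$, and let $\kappa\in\mathbb K\setminus\mathbb F_p$. Then there does not exist a nonzero rational $V$-valued function $f(z_1,\dots,z_n)$ which is a solution of the qKZ equations with step $\kappa$, i.e. the only rational function $f$ in $z_1,\dots,z_n$ over $\mathbb K$ with values in $V$ satisfying $f(z_1,\dots,z_a-\kappa,\dots,z_n)=K_a(z;\kappa)f(z)$ for all $a=1,\dots,n$ is $f=0$.
   Context: $\mathbb K$ is a field of characteristic $p$ (prime), $\mathbb F_p\subset\mathbb K$ its prime subfield, $n>1$ an integer, $z=(z_1,\dots,z_n)$ variables. $L$ is the $2$-dimensional $\mathbb K$-vector space with basis $v_1,v_2$ (the vector representation of $\mathfrak{sl}_2$: $ev_1=0$, $ev_2=v_1$). Let $P$ be the permutation of tensor factors of $L^{\otimes 2}$ and $R(u)=\frac{u-P}{u-1}$. On $L^{\otimes n}$, $R^{(i,j)}(u)$ denotes $R(u)$ acting in the $i$-th and $j$-th tensor factors. For $\kappa\in\mathbb K^\times$ and $a=1,\dots,n$, $$K_a(z;\kappa)=R^{(a,a-1)}(z_a-z_{a-1}-\kappa)\cdots R^{(a,1)}(z_a-z_1-\kappa)\,R^{(a,n)}(z_a-z_n)\cdots R^{(a,a+1)}(z_a-z_{a+1}).$$ The qKZ equations with step $\kappa$ are $f(z_1,\dots,z_a-\kappa,\dots,z_n)=K_a(z;\kappa)f(z)$, $a=1,\dots,n$. Let $v^{(i)}=v_1\otimes\cdots\otimes v_2\otimes\cdots\otimes v_1$ with the only $v_2$ at the $i$-th place,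 $i=1,\dots,n$. $V=\operatorname{Sing}L^{\otimes n}[n-2]=\{\sum_i x_iv^{(i)}\mid x_i\in\mathbb K,\ \sum_i x_i=0\}$ (the vectors in the span of the $v^{(i)}$ annihilated by $e$); $\dim V=n-1$. The operators $K_a(z;\kappa)$ preserve $V$. *)

(* Defs.v *)
From HB Require Import structures.
From mathcomp Require Import all_boot all_order all_algebra perm.
From mathcomp Require Import mpoly.

Set Implicit Arguments.
Unset Strict Implicit.
Unset Printing Implicit Defensive.

Import GRing.Theory.
Local Open Scope ring_scope.

Local Notation "x %:F" := (@FracField.tofrac _ x).

Definition in_prime_subfield (K : fieldType) (p : nat) (x : K) : Prop :=
  exists c : 'F_p, x = (nat_of_ord c)%:R.

Notation ratfun K n := {fraction {mpoly K[n]}}.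

Section RationalFunctions.
Variables (K : fieldType) (n : nat).

Definition zvar (i : 'I_n) : ratfun K n := ('X_i : {mpoly K[n]})%:F.
Definition rconst (c : K) : ratfun K n := (c%:MP : {mpoly K[n]})%:F.

Definition poly_shift (a : 'I_n) (kappa : K) (q : {mpoly K[n]}) : {mpoly K[n]} :=
  q \mPo [tuple 'X_i - (if i == a then kappa else 0)%:MP | i < n].

(* f(z_1, ..., z_a - kappa, ..., z_n).  The fraction representing f is chosen
   by [repr]; [ratfun_shift_div] shows that the choice is irrelevant. *)
Definition ratfun_shift (a : 'I_n) (kappa : K) (f : ratfun K n) : ratfun K n :=
  (poly_shift a kappa \n_(repr f))%:F / (poly_shift a kappa \d_(repr f))%:F.

Lemma poly_shiftK (a : 'I_n) (kappa : K) :
  cancel (poly_shift a kappa) (poly_shift a (- kappa)).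
Proof.
move=> q; rewrite /poly_shift.
set s := (X in q \mPo X); set t := (X in _ \mPo X).
rewrite [q \mPo s]comp_mpolyE raddf_sum /= -[RHS]comp_mpoly_id [RHS]comp_mpolyE.
apply: eq_bigr => m _; rewrite comp_mpolyZ rmorph_prod; congr (_ *: _).
apply: eq_bigr => i _; rewrite rmorphXn; congr (_ ^+ _).
rewrite !tnth_mktuple /= raddfB /= comp_mpolyC comp_mpolyXU.
rewrite (nth_map i) ?size_enum_ord // nth_ord_enum.
by case: eqP => _; rewrite ?mpolyCN ?opprK ?addrK // mpolyC0 !subr0.
Qed.

Lemma ratfun_shift_div (a : 'I_n) (kappa : K) (g h : {mpoly K[n]}) : h != 0 ->
  ratfun_shift a kappa (g%:F / h%:F) =
  (poly_shift a kappa g)%:F / (poly_shift a kappa h)%:F.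
Proof.
pose sh := poly_shift a kappa => h0.
have shM : {morph sh : x y / x * y} by move=> x y; rewrite /sh /poly_shift rmorphM.
have sh_eq0 x : x != 0 -> (sh x)%:F != 0.
  rewrite tofrac_eq0; apply: contra_neq => shx0.
  rewrite -(poly_shiftK a kappa x) -/(sh x) shx0.
  exact: (raddf0 (comp_mpoly _)).
have fracE (f : ratfun K n) : f = (\n_(repr f))%:F / (\d_(repr f))%:F.
  have d0 : \d_(repr f) != 0 by exact: denom_ratioP.
  apply: (mulIf (x := (\d_(repr f))%:F)); first by rewrite tofrac_eq0.
  rewrite divfK ?tofrac_eq0 // -{1}[f]reprK.
  unlock FracField.tofrac; rewrite -[LHS]FracField.pi_mul.
  apply/eqmodP; rewrite /= FracField.equivfE /FracField.mulf.
  by rewrite !numden_Ratio ?mulf_neq0 ?oner_eq0 // !mulr1 mulrC.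
rewrite /ratfun_shift -/sh; set f := (g%:F / h%:F).
have d0 : \d_(repr f) != 0 by exact: denom_ratioP.
apply/eqP; rewrite eqr_div ?sh_eq0 // -!tofracM -!shM tofrac_eq.
suff -> : \n_(repr f) * h = g * \d_(repr f) by rewrite /=.
apply/eqP; rewrite -tofrac_eq !tofracM -eqr_div ?tofrac_eq0 //.
by rewrite -fracE.
Qed.

End RationalFunctions.

(* L^{(x) n} with scalars extended to F: the value at s of an element is its
   coordinate on v_{s_1} (x) ... (x) v_{s_n}, where 0 : 'I_2 stands for v_1 and
   1 : 'I_2 for v_2. *)
Notation Ltensor F n := {ffun {ffun 'I_n -> 'I_2} -> F^o}.

Section TensorSpace.
Variables (F : fieldType) (n : nat).

(* P acting in the i-th and j-th tensor factors *)
Definition swap_factors (i j : 'I_n) (x : Ltensor F n) : Ltensor F n :=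
  [ffun s : {ffun 'I_n -> 'I_2} => x [ffun k => s (tperm i j k)]].

Definition Rmat (i j : 'I_n) (u : F) (x : Ltensor F n) : Ltensor F n :=
  (u - 1)^-1 *: (u *: x - swap_factors i j x).

Definition vbase (i : 'I_n) : Ltensor F n :=
  [ffun s : {ffun 'I_n -> 'I_2} =>
     (s == [ffun k => if k == i then 1 else 0])%:R].

(* Membership in Sing L^{(x) n}[n-2], extended to F. *)
Definition in_Sing (x : Ltensor F n) : Prop :=
  exists c : 'I_n -> F, x = \sum_i c i *: vbase i /\ \sum_i c i = 0.

End TensorSpace.

Section QKZ.
Variables (K : fieldType) (n : nat).

(* Composition from left to right along decreasing j, first over j < a, then
   over j > a, so that the factor (a, a+1) acts first. *)
Definition qKZ_operator (kappa : K) (a : 'I_n) :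
    Ltensor (ratfun K n) n -> Ltensor (ratfun K n) n :=
  (\big[comp/id]_(j <- rev (enum 'I_n) | (j < a)%N)
      Rmat a j (zvar K a - zvar K j - rconst n kappa))
  \o
  (\big[comp/id]_(j <- rev (enum 'I_n) | (a < j)%N)
      Rmat a j (zvar K a - zvar K j)).

Definition qKZ_solution (kappa : K) (f : Ltensor (ratfun K n) n) : Prop :=
  forall a : 'I_n,
    [ffun s => ratfun_shift a kappa (f s)] = qKZ_operator kappa a f.

End QKZ.

(* Main.v *)
(* Compare both sides at infinity.  Let d be the degree of f.  Modulo terms of
   degree below d - 1, f(z - kappa e_a) - f is -kappa times the a-th partial
   derivative of the top degree part of f, and K_a f - f is the sum over j of
   (1 - P^(a,j)) f / (z_a - z_j).  Multiplying by z_a and summing over a, Euler's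
   identity turns the left side into -kappa d f, while the right side becomes
   the sum over i < j of (1 - P^(i,j)) f, which is n f on Sing.  Hence
   kappa d + n = 0 in K; as p does not divide n, kappa lies in F_p. *)
Require Import Defs.
From mathcomp Require Import all_boot all_order all_algebra perm.
From mathcomp Require Import mpoly ring zify.

Set Implicit Arguments.
Unset Strict Implicit.
Unset Printing Implicit Defensive.

Import GRing.Theory.
Local Open Scope ring_scope.

Local Notation "x %:F" := (@FracField.tofrac _ x).

(** * Degrees of polynomials under shifts of the variables *)

Section PolynomialDegree.
Variables (K : fieldType) (n : nat).
Implicit Types p q : {mpoly K[n]}.

Lemma msizeD_bound p q d :
  (msize p <= d)%N -> (msize q <= d)%N -> (msize (p + q) <= d)%N.
Proof.
by move=> hp hq; apply: leq_trans (mmeasureD_le _ _ _) _; rewrite geq_max hp.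
Qed.

Lemma msizeB_bound p q d :
  (msize p <= d)%N -> (msize q <= d)%N -> (msize (p - q) <= d)%N.
Proof. by move=> hp hq; apply: msizeD_bound => //; rewrite mmeasureN. Qed.

(** [msize] is the degree plus one, and 0 for the zero polynomial; a product therefore loses one of
    the two offsets. *)
Lemma msizeM_bound p q d e :
  (msize p <= d)%N -> (msize q <= e.+1)%N -> (msize (p * q) <= d + e)%N.
Proof.
have [->|p0] := eqVneq p 0; first by rewrite mul0r mmeasure0.
have [->|q0] := eqVneq q 0; first by rewrite mulr0 mmeasure0.
rewrite msizeM // (mpolySpred mdeg q0) addnS /= ltnS; exact: leq_add.
Qed.

Lemma msizeCM_bound c p d :
  (msize p <= d)%N -> (msize (c%:MP * p) <= d)%N.
Proof. by rewrite mul_mpolyC; apply: leq_trans; exact: msizeZ_le. Qed.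

Lemma msize_sum_bound (I : Type) (r : seq I) (P : pred I)
    (F : I -> {mpoly K[n]}) d :
  (forall i, P i -> (msize (F i) <= d)%N) ->
  (msize (\sum_(i <- r | P i) F i) <= d)%N.
Proof.
move=> h; elim/big_rec: _ => [|i x Pi hx]; first by rewrite mmeasure0.
by apply: msizeD_bound => //; apply: h.
Qed.

Lemma msizeXU (i : 'I_n) : msize ('X_i : {mpoly K[n]}) = 2.
Proof. by rewrite mmeasureX /= mdeg1. Qed.

Lemma msize_Xdiff (a j : 'I_n) (c : K) : a != j ->
  msize ('X_a - 'X_j - c%:MP : {mpoly K[n]}) = 2.
Proof.
move=> aj; apply/eqP; rewrite eqn_leq; apply/andP; split.
  apply: msizeB_bound; first by apply: msizeB_bound; rewrite msizeXU.
  by rewrite mmeasureC; case: eqP.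
suff : U_(a)%MM \in msupp ('X_a - 'X_j - c%:MP : {mpoly K[n]}).
  by move/msize_mdeg_lt; rewrite mdeg1.
rewrite mcoeff_msupp !mcoeffB !mcoeffXU mcoeffC eqxx (eq_sym j a) (negPf aj).
by rewrite mnm1_eq0 mulr0 !subr0 oner_eq0.
Qed.

Variable kappa : K.
Local Notation sh a := (@poly_shift K n a kappa).

Lemma poly_shiftD (a : 'I_n) : {morph sh a : p q / p + q}.
Proof. by move=> p q; rewrite /poly_shift rmorphD. Qed.

Lemma poly_shiftM (a : 'I_n) : {morph sh a : p q / p * q}.
Proof. by move=> p q; rewrite /poly_shift rmorphM. Qed.

Lemma poly_shiftC (a : 'I_n) (c : K) : sh a c%:MP = c%:MP.
Proof. by rewrite /poly_shift comp_mpolyC. Qed.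

Lemma poly_shiftX (a i : 'I_n) : sh a 'X_i = 'X_i - (if i == a then kappa else 0)%:MP.
Proof.
by rewrite /poly_shift comp_mpolyXU (nth_map i) ?size_enum_ord // nth_ord_enum.
Qed.

Definition euler_shift p := \sum_a 'X_a * (sh a p - p).

(* Modulo lower order terms [sh a p - p] is [- kappa] times the derivative of
   [p], so this is Euler's identity for the part of degree [d] of [p]. *)
Definition shift_euler d p :=
  [/\ (msize p <= d.+1)%N,
      forall a, (msize (sh a p - p) <= d)%N
    & (msize (euler_shift p + (kappa *+ d)%:MP * p) <= d)%N].

(** The Leibniz rule for the difference [sh a p - p] has an extra term, the product of the two
    differences. Its degree is lower by two, so it remains negligible after the factor ['X_a]. *)
Lemma shift_eulerM d e p q :
  shift_euler d p -> shift_euler e q -> shift_euler (d + e) (p * q).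
Proof.
move=> [p1 p2 p3] [q1 q2 q3]; split.
- by rewrite -addSn msizeM_bound.
- move=> a; rewrite poly_shiftM.
  have -> : sh a p * sh a q - p * q =
    (sh a p - p) * q + (sh a q - q) * p + (sh a p - p) * (sh a q - q) by ring.
  apply: msizeD_bound; last by apply: msizeM_bound => //; exact: leqW.
  by apply: msizeD_bound; [|rewrite addnC]; apply: msizeM_bound.
have -> : euler_shift (p * q) + (kappa *+ (d + e))%:MP * (p * q) =
    (euler_shift p + (kappa *+ d)%:MP * p) * q
  + (euler_shift q + (kappa *+ e)%:MP * q) * p
  + \sum_a 'X_a * ((sh a p - p) * (sh a q - q)).
  rewrite mulrnDr mpolyCD.
  suff -> : euler_shift (p * q) = euler_shift p * q + euler_shift q * p
    + \sum_a 'X_a * ((sh a p - p) * (sh a q - q)) by ring.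
  rewrite /euler_shift !mulr_suml -!big_split /=; apply: eq_bigr => a _.
  by rewrite poly_shiftM; ring.
apply: msizeD_bound.
  by apply: msizeD_bound; [|rewrite addnC]; apply: msizeM_bound.
apply: msize_sum_bound => a _; rewrite mulrA.
(* The degree bound for products wants the second size as a successor, hence the separate zero
   case. *)
have [->|hq] := eqVneq (sh a q - q) 0; first by rewrite mulr0 mmeasure0.
have h : (msize ('X_a * (sh a p - p)) <= d.+1)%N.
  by rewrite mulrC -addn1 msizeM_bound // msizeXU.
apply: leq_trans (@msizeM_bound _ _ d.+1 (msize (sh a q - q)).-1 h _) _.
  by rewrite -mpolySpred.
by rewrite addSnnS -mpolySpred // leq_add2l.
Qed.

Lemma shift_eulerC (c : K) : shift_euler 0 c%:MP.
Proof.
have h a : sh a c%:MP - c%:MP = 0 by rewrite poly_shiftC subrr.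
split=> [|a|]; first by rewrite mmeasureC; case: eqP.
  by rewrite h mmeasure0.
rewrite mulr0n mpolyC0 mul0r addr0 /euler_shift big1 ?mmeasure0 // => a _.
by rewrite h mulr0.
Qed.

Lemma shift_eulerX i : shift_euler 1 'X_i.
Proof.
have h a : sh a 'X_i - 'X_i = - (if i == a then kappa else 0)%:MP.
  by rewrite poly_shiftX; ring.
split=> [|a|]; first by rewrite msizeXU.
  by rewrite h mmeasureN mmeasureC; case: eqP.
rewrite /euler_shift (bigD1 i) //= h eqxx big1 => [|a ai].
  by rewrite mulr1n addr0 mulrN mulrC addNr mmeasure0.
by rewrite h eq_sym (negPf ai) mpolyC0 oppr0 mulr0.
Qed.

Lemma shift_eulerXn (m : 'X_{1..n}) : shift_euler (mdeg m) 'X_[m].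
Proof.
rewrite mpolyXE_id mdegE.
apply: (big_ind2 (fun p d => shift_euler d p)).
- by rewrite -mpolyC1; exact: shift_eulerC.
- by move=> p d q e; exact: shift_eulerM.
move=> i _; elim: (m i) => [|k IH].
  by rewrite expr0 -mpolyC1; exact: shift_eulerC.
by rewrite exprS -add1n; exact: shift_eulerM (shift_eulerX i) IH.
Qed.

(** Raising [d] by one adds only [kappa%:MP * p], which fits the weaker bound. *)
Lemma shift_eulerW d e p : (d <= e)%N -> shift_euler d p -> shift_euler e p.
Proof.
move/subnK <-; elim: (e - d)%N => [//|k IH] /IH [p1 p2 p3].
split; first exact: ltnW.
  by move=> a; apply: leqW.
rewrite addSn mulrSr mpolyCD mulrDl addrA.
by apply: msizeD_bound; [exact: leqW|exact: msizeCM_bound].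
Qed.

Lemma shift_eulerD d p q :
  shift_euler d p -> shift_euler d q -> shift_euler d (p + q).
Proof.
move=> [p1 p2 p3] [q1 q2 q3]; split; first exact: msizeD_bound.
  move=> a; rewrite poly_shiftD.
  have -> : sh a p + sh a q - (p + q) = (sh a p - p) + (sh a q - q) by ring.
  exact: msizeD_bound.
suff -> : euler_shift (p + q) = euler_shift p + euler_shift q.
  by rewrite mulrDr addrACA; exact: msizeD_bound.
rewrite /euler_shift -big_split /=; apply: eq_bigr => a _.
by rewrite poly_shiftD; ring.
Qed.

(** Constants and variables generate all polynomials, and the property passes to products, to sums
    and to larger [d]. *)
Lemma shift_euler_msize d p : (msize p <= d.+1)%N -> shift_euler d p.
Proof.
move=> hd; rewrite [p]mpolyE big_seq.
elim/big_rec: _ => [|m q /msize_mdeg_lt hm].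
  by rewrite -mpolyC0; apply: (@shift_eulerW 0) => //; exact: shift_eulerC.
apply: shift_eulerD; rewrite -mul_mpolyC.
apply: (@shift_eulerW (0 + mdeg m)); first exact: leq_trans hm hd.
by apply: shift_eulerM (shift_eulerXn m); exact: shift_eulerC.
Qed.

Lemma poly_shift_eq0 a p : (sh a p == 0) = (p == 0).
Proof.
apply/eqP/eqP => [h|->]; last by rewrite -mpolyC0 poly_shiftC.
rewrite -(poly_shiftK a kappa p) h -mpolyC0 /poly_shift.
exact: comp_mpolyC.
Qed.

Lemma msize_poly_shift a p : (msize (sh a p) <= msize p)%N.
Proof.
have [->|p0] := eqVneq p 0; first by rewrite -mpolyC0 poly_shiftC.
have [_ h _] : shift_euler (msize p).-1 p.
  by apply: shift_euler_msize; rewrite -mpolySpred.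
rewrite -[sh a p](subrK p); apply: msizeD_bound => //.
exact: leq_trans (h a) (leq_pred _).
Qed.

End PolynomialDegree.

(** * Rational functions filtered by degree at infinity *)

Lemma invrB_shift (F : fieldType) (z u c : F) : u != 0 -> u - c != 0 ->
  z * ((u - c)^-1 - u^-1) = z * (u - c)^-1 * (c * u^-1).
Proof. by move=> u0 uc0; field; rewrite u0 uc0. Qed.

(** A discrete logarithmic derivative: the relative increment of a quotient is the difference of the
    relative increments, up to a correction quadratic in them. *)
Lemma divr_ratio_sub1 (F : fieldType) (g g' h h' : F) :
  g != 0 -> h != 0 -> h' != 0 ->
  (g' / h' - g / h) / (g / h) =
  (g' - g) / g - (h' - h) / h
  - (h' - h) / h * (((g' - g) / g - (h' - h) / h) * (h / h')).
Proof. by move=> g0 h0 h0'; field; rewrite g0 h0 h0'. Qed.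

Section DegreeAtInfinity.
Variables (K : fieldType) (n : nat).
Implicit Types (x y : ratfun K n) (b : bool).

(* Total degree at most [- b]: for [b = false] this is the valuation ring of
   the degree at infinity, for [b = true] its maximal ideal. *)
Definition degle b x := exists g h : {mpoly K[n]},
  [/\ h != 0, x = g%:F / h%:F & (msize g + b <= msize h)%N].

Lemma msizeM_degle b (g h k : {mpoly K[n]}) : h != 0 -> k != 0 ->
  (msize g + b <= msize h)%N -> (msize (g * k) + b <= msize (h * k))%N.
Proof.
move=> h0 k0 gh; rewrite (msizeM h0 k0) [in leqRHS](mpolySpred mdeg k0) addnS /=.
have [->|g0] := eqVneq g 0.
  rewrite mul0r mmeasure0 (mpolySpred mdeg h0).
  by case: b {gh}; rewrite ?add0n ?addSn.
rewrite (msizeM g0 k0) [in leqLHS](mpolySpred mdeg k0) addnS /= addnAC.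
by rewrite leq_add2r.
Qed.

Lemma degleD b x y : degle b x -> degle b y -> degle b (x + y).
Proof.
move=> [g [h [h0 -> gh]]] [g' [h' [h0' -> gh']]].
exists (g * h' + g' * h), (h * h'); split; first exact: mulf_neq0.
  by rewrite tofracD !tofracM addf_div ?tofrac_eq0.
have /= A := msizeM_degle h0 h0' gh.
have /= B := msizeM_degle h0' h0 gh'.
rewrite [h' * h]mulrC in B.
have le_b : (b <= msize (h * h'))%N by apply: leq_trans A; exact: leq_addl.
by rewrite addnC -leq_subRL //; apply: msizeD_bound; rewrite leq_subRL // addnC.
Qed.

Lemma degleN b x : degle b x -> degle b (- x).
Proof.
move=> [g [h [h0 -> gh]]]; exists (- g), h; split=> //.
  by rewrite tofracN mulNr.
by rewrite mmeasureN.
Qed.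

Lemma degleB b x y : degle b x -> degle b y -> degle b (x - y).
Proof. by move=> hx hy; apply/degleD/degleN. Qed.

Lemma degle0 b : degle b 0.
Proof.
exists 0, 1; rewrite oner_eq0 tofrac0 mul0r mmeasure0 msize1; split=> //.
by case: b.
Qed.

(** The bound is [b || b'] and not a sum because [degle] records nothing finer than degree at most
    -1. *)
Lemma degleM b b' x y : degle b x -> degle b' y -> degle (b || b') (x * y).
Proof.
move=> [g [h [h0 -> gh]]] [g' [h' [h0' -> gh']]].
exists (g * g'), (h * h'); split; first exact: mulf_neq0.
  by rewrite !tofracM mulf_div.
have [->|g0'] := eqVneq g' 0.
  rewrite mulr0 mmeasure0 (mpolySpred mdeg (mulf_neq0 h0 h0')).
  by case: (b || b').
case: b gh => gh.
  apply: leq_trans (msizeM_degle h0 g0' gh) _.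
  rewrite mulrC [h * h']mulrC -[leqLHS]addn0.
  apply: (@msizeM_degle false) => //.
  by apply: leq_trans gh'; rewrite addn0 leq_addr.
apply: leq_trans (_ : (msize (h * g') + b' <= _)%N).
  rewrite leq_add2r -[leqLHS]addn0.
  exact: (@msizeM_degle false).
by rewrite mulrC [h * h']mulrC; apply: msizeM_degle.
Qed.

Lemma degleW b x : degle true x -> degle b x.
Proof.
case: b => // -[g [h [h0 -> gh]]]; exists g, h; split=> //.
by rewrite addn0; apply: leq_trans gh; exact: leq_addr.
Qed.

Lemma degle_sum b (I : Type) (r : seq I) (P : pred I) (F : I -> ratfun K n) :
  (forall i, P i -> degle b (F i)) -> degle b (\sum_(i <- r | P i) F i).
Proof.
move=> h; elim/big_rec: _ => [|i x Pi hx]; first exact: degle0.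
by apply: degleD => //; apply: h.
Qed.

Lemma degle_rconst c : degle false (rconst n c).
Proof.
exists c%:MP, 1; rewrite oner_eq0 tofrac1 divr1 mmeasureC msize1; split=> //.
by case: (c != 0).
Qed.

(** A nonzero constant has degree exactly 0. This turns the final estimate at infinity into an
    equation in [K]. *)
Lemma degle_rconst_eq0 c : degle true (rconst n c) -> c = 0.
Proof.
move=> [g [h [h0 E gh]]]; apply/eqP/negPn/negP => c0; move: gh.
suff -> : g = c *: h by rewrite msizeZ // addn1 ltnn.
apply/eqP; rewrite -tofrac_eq -mul_mpolyC tofracM.
by rewrite -[_%:F in X in _ == X]/(rconst n c) E divfK // tofrac_eq0.
Qed.

Lemma rconstD : forall c d : K, rconst n (c + d) = rconst n c + rconst n d.
Proof. by move=> c d; rewrite /rconst mpolyCD tofracD. Qed.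

Lemma rconstB : forall c d : K, rconst n (c - d) = rconst n c - rconst n d.
Proof. by move=> c d; rewrite /rconst mpolyCB tofracB. Qed.

Lemma rconst1 : rconst n (1 : K) = 1.
Proof. by rewrite /rconst mpolyC1 tofrac1. Qed.

Lemma rconst0 : rconst n (0 : K) = 0.
Proof. by rewrite /rconst mpolyC0 tofrac0. Qed.

Lemma rconst_nat k : rconst n (k%:R : K) = k%:R.
Proof.
by elim: k => [|k IH]; rewrite ?rconst0 // -natr1 rconstD IH rconst1 natr1.
Qed.

Section LinearForms.
Variables (a j : 'I_n) (aj : a != j).

Lemma zdiffE c : zvar K a - zvar K j - rconst n c =
  ('X_a - 'X_j - c%:MP : {mpoly K[n]})%:F.
Proof. by rewrite !tofracB. Qed.

Lemma Xdiff_neq0 (c : K) : ('X_a - 'X_j - c%:MP : {mpoly K[n]}) != 0.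
Proof. by rewrite -(mmeasure_poly_eq0 mdeg) msize_Xdiff. Qed.

Lemma zdiff_neq0 c : zvar K a - zvar K j - rconst n c != 0.
Proof. by rewrite zdiffE tofrac_eq0 Xdiff_neq0. Qed.

Lemma degle_zdiffV c : degle true (zvar K a - zvar K j - rconst n c)^-1.
Proof.
exists 1, ('X_a - 'X_j - c%:MP).
by rewrite Xdiff_neq0 zdiffE tofrac1 mul1r msize1 msize_Xdiff.
Qed.

Lemma degle_zvar_zdiff c :
  degle false (zvar K a * (zvar K a - zvar K j - rconst n c)^-1).
Proof.
exists 'X_a, ('X_a - 'X_j - c%:MP).
by rewrite Xdiff_neq0 zdiffE msizeXU msize_Xdiff.
Qed.

(** The two inverses differ in degree -2 only, so constants added to [z_a - z_j] do not affect the
    leading order. *)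
Lemma degle_zvar_zdiffB c : degle true (zvar K a *
  ((zvar K a - zvar K j - rconst n c)^-1 - (zvar K a - zvar K j)^-1)).
Proof.
have e0 : zvar K a - zvar K j - rconst n 0 = zvar K a - zvar K j.
  by rewrite rconst0 subr0.
have := degle_zdiffV 0; have := zdiff_neq0 0; rewrite e0 => h0 hV.
rewrite (invrB_shift _ h0 (zdiff_neq0 c)).
apply: (@degleM false true); first exact: degle_zvar_zdiff.
by apply: (@degleM false true); [exact: degle_rconst|].
Qed.

End LinearForms.

Lemma ratfunE x : x = (\n_(repr x))%:F / (\d_(repr x))%:F.
Proof.
have d0 : \d_(repr x) != 0 by exact: denom_ratioP.
apply: (mulIf (x := (\d_(repr x))%:F)); first by rewrite tofrac_eq0.
rewrite divfK ?tofrac_eq0 // -{1}[x]reprK.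
(* Both sides become classes of pairs, which are compared by cross multiplication. *)
unlock FracField.tofrac; rewrite -[LHS]FracField.pi_mul.
apply/eqmodP; rewrite /= FracField.equivfE /FracField.mulf.
by rewrite !numden_Ratio ?mulf_neq0 ?oner_eq0 // !mulr1 mulrC.
Qed.

(** The hypothesis compares the degrees of [x] and [y], numerator minus denominator, in a form free
    of subtraction. *)
Lemma degle_div x y : y != 0 ->
  (msize \n_(repr x) + msize \d_(repr y) <=
   msize \n_(repr y) + msize \d_(repr x))%N ->
  degle false (x / y).
Proof.
have dx0 : \d_(repr x) != 0 by exact: denom_ratioP.
have dy0 : \d_(repr y) != 0 by exact: denom_ratioP.
move=> y0 le; have ny0 : \n_(repr y) != 0.
  by apply: contra_neq y0 => e; rewrite [y]ratfunE e tofrac0 mul0r.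
exists (\n_(repr x) * \d_(repr y)), (\n_(repr y) * \d_(repr x)); split.
- exact: mulf_neq0.
- rewrite {1}[x]ratfunE {1}[y]ratfunE invf_div mulf_div !tofracM.
  by rewrite [_ * (\n_(repr y))%:F]mulrC.
have [->|nx0] := eqVneq \n_(repr x) 0; first by rewrite mul0r mmeasure0.
by rewrite addn0 !msizeM // -!subn1 leq_sub2r.
Qed.

Section Shift.
Variable kappa : K.
Local Notation sh a := (@poly_shift K n a kappa).

Lemma degle_shift_euler (q : {mpoly K[n]}) : q != 0 ->
  [/\ forall a, degle true (((sh a q)%:F - q%:F) / q%:F),
      forall a, degle false (zvar K a * (((sh a q)%:F - q%:F) / q%:F))
    & degle true (\sum_a zvar K a * (((sh a q)%:F - q%:F) / q%:F)
                  + rconst n (kappa *+ (msize q).-1))].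
Proof.
move=> q0; have [_ h1 h2] : shift_euler kappa (msize q).-1 q.
  by apply: shift_euler_msize; rewrite -mpolySpred.
split=> [a|a|].
- exists (sh a q - q), q; split=> //; first by rewrite tofracB.
  by rewrite addn1 (mpolySpred mdeg q0) ltnS.
- exists ('X_a * (sh a q - q)), q; split=> //.
    by rewrite tofracM tofracB mulrA.
  rewrite addn0 mulrC (mpolySpred mdeg q0) -addn1 msizeM_bound // msizeXU //.
exists (euler_shift kappa q + (kappa *+ (msize q).-1)%:MP * q), q; split=> //.
  rewrite tofracD tofracM mulrDl mulfK ?tofrac_eq0 //; congr (_ + _).
  rewrite /euler_shift raddf_sum mulr_suml; apply: eq_bigr => a _ /=.
  by rewrite tofracM tofracB mulrA.
by rewrite addn1 (mpolySpred mdeg q0) ltnS.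
Qed.

(** Euler's identity for a quotient. The witnesses are the degrees of a numerator and a denominator,
    kept apart since [d - e] may be negative. *)
Lemma degle_ratfun_shift x : x != 0 -> exists d e : nat,
  degle true (\sum_a zvar K a * ((ratfun_shift a kappa x - x) / x)
              + rconst n (kappa *+ d - kappa *+ e)).
Proof.
move=> x0; have h0 : \d_(repr x) != 0 by exact: denom_ratioP.
have g0 : \n_(repr x) != 0.
  by apply: contra_neq x0 => e; rewrite [x]ratfunE e tofrac0 mul0r.
move: (ratfunE x) g0 h0; move: \n_(repr x) \d_(repr x) => g h Ex g0 h0.
exists (msize g).-1, (msize h).-1.
have [g1 g2 g3] := degle_shift_euler g0; have [h1 h2 h3] := degle_shift_euler h0.
pose eg a := ((sh a g)%:F - g%:F) / g%:F; pose eh a := ((sh a h)%:F - h%:F) / h%:F.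
have -> : \sum_a zvar K a * ((ratfun_shift a kappa x - x) / x) =
    \sum_a zvar K a * eg a - \sum_a zvar K a * eh a
    - \sum_a (zvar K a * eh a) * ((eg a - eh a) * (h%:F / (sh a h)%:F)).
  rewrite -!sumrB; apply: eq_bigr => a _.
  rewrite Ex ratfun_shift_div // /eg /eh.
  rewrite divr_ratio_sub1 ?tofrac_eq0 ?poly_shift_eq0 //.
  by rewrite mulrBr [X in X - _]mulrBr; congr (_ - _); exact: mulrA.
rewrite rconstB.
rewrite addrAC addrACA -opprD.
apply: degleB; first exact: degleB.
apply: degle_sum => a _; apply: (@degleM false true) => //.
apply: (@degleM true false); first by apply: degleB; [exact: g1|exact: h1].
(* The shift by [- kappa] undoes [sh a] and does not raise the degree, so [h] is no larger than
   [sh a h]. *)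
exists h, (sh a h); rewrite poly_shift_eq0 h0 addn0; split=> //.
by rewrite -{1}(poly_shiftK a kappa h) msize_poly_shift.
Qed.

End Shift.
End DegreeAtInfinity.

(** * Expansion of the qKZ operators at infinity *)

(** Uses [R(u) = 1 + (1 - P) / (u - 1)]. Primes mark coordinates at the swapped index, and [w]
    stands for [(z_a - z_j)^-1]. The summands are the error inherited from [y], that of putting [x]
    for [y] under [1 - P], and that of putting [w] for [(u - 1)^-1]. *)
Lemma Rmat_coord_expansion (F : fieldType) (z c w x x' y y' u t : F) :
  u - 1 != 0 ->
  z * (((u - 1)^-1 * (u * y - y') - x - (t + w * (x - x'))) / c) =
  z * ((y - x - t) / c) + (z * (u - 1)^-1) * ((y - x) / c - (y' - x') / c)
  + (z * ((u - 1)^-1 - w)) * (x / c - x' / c).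
Proof.
move=> u0.
have -> : (u - 1)^-1 * (u * y - y') = y + (u - 1)^-1 * (y - y') by field.
ring.
Qed.

Lemma Rmat_coord_sub (F : fieldType) (c u x x' y y' : F) : u - 1 != 0 ->
  ((u - 1)^-1 * (u * y - y') - x) / c =
  (y - x) / c
  + (u - 1)^-1 * (((y - x) / c - (y' - x') / c) + (x / c - x' / c)).
Proof.
move=> u0.
have -> : (u - 1)^-1 * (u * y - y') = y + (u - 1)^-1 * (y - y') by field.
ring.
Qed.

Section Operators.
Variables (K : fieldType) (n : nat).
Local Notation F := (ratfun K n).
Implicit Types (c : F) (x y T : Ltensor F n) (s : {ffun 'I_n -> 'I_2}).

(* Relative to the size [c] of [x], the vector [y - x] has negative degree and
   [T] is its part of degree [-1]. *)
Definition approx (a : 'I_n) c x y T :=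
  forall s, degle true ((y s - x s) / c) /\
            degle true (zvar K a * ((y s - x s - T s) / c)).

Lemma approx_refl a c x : approx a c x x 0.
Proof.
by move=> s; rewrite ffunE subrr sub0r oppr0 mul0r mulr0; split; exact: degle0.
Qed.

(** To order -1 the new factor acts on [x] instead of [y], since [y - x] already has negative
    relative degree; first order terms therefore add up. *)
Lemma approx_Rmat (a j : 'I_n) (b : K) (u : F) c x y T : a != j ->
  u = zvar K a - zvar K j - rconst n b ->
  (forall s, degle false (x s / c)) -> approx a c x y T ->
  approx a c x (Rmat a j u y)
    (T + (zvar K a - zvar K j)^-1 *: (x - swap_factors a j x)).
Proof.
move=> aj uE hx hxy s; set s' := [ffun k => s (tperm a j k)].
have u1 : u - 1 = zvar K a - zvar K j - rconst n (b + 1).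
  by rewrite uE rconstD rconst1 opprD addrA.
have u0 : u - 1 != 0 by rewrite u1 zdiff_neq0.
have [h1 h2] := hxy s; have [h1' _] := hxy s'.
have hxx := degleB (hx s) (hx s'); have hyx := degleB h1 h1'.
have yE : Rmat a j u y s = (u - 1)^-1 * (u * y s - y s') by rewrite !ffunE.
have TE : (T + (zvar K a - zvar K j)^-1 *: (x - swap_factors a j x)) s =
    T s + (zvar K a - zvar K j)^-1 * (x s - x s') by rewrite !ffunE.
rewrite yE TE; split.
  rewrite (Rmat_coord_sub c (x s) (x s') (y s) (y s') u0); apply: degleD => //.
  apply: (@degleM _ _ true false).
    by rewrite u1; exact: degle_zdiffV.
  by apply: degleD => //; exact: degleW.
rewrite (Rmat_coord_expansion _ _ _ _ _ _ _ _ u0).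
apply: degleD; first apply: degleD => //.
- apply: (@degleM _ _ false true) => //.
  by rewrite u1; exact: degle_zvar_zdiff.
- apply: (@degleM _ _ true false) => //.
  by rewrite u1; exact: degle_zvar_zdiffB.
Qed.

Lemma approx_prod (a : 'I_n) (b : K) (U : 'I_n -> F) (r : seq 'I_n)
    (P : pred 'I_n) c x y T :
  (forall j, P j -> a != j /\ U j = zvar K a - zvar K j - rconst n b) ->
  (forall s, degle false (x s / c)) -> approx a c x y T ->
  approx a c x ((\big[comp/id]_(j <- r | P j) Rmat a j (U j)) y)
    (T + \sum_(j <- r | P j)
       (zvar K a - zvar K j)^-1 *: (x - swap_factors a j x)).
Proof.
move=> hU hx hxy; elim: r => [|j r IH]; first by rewrite !big_nil addr0.
rewrite !big_cons; case: ifP => // /hU [aj Uj].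
by rewrite [X in T + X]addrC addrA; exact: approx_Rmat Uj hx IH.
Qed.

(** The factors with [j < a] carry the constant [kappa] and those with [a < j] carry 0. This is
    invisible at order -1, so the two sums merge. *)
Lemma approx_qKZ (kappa : K) (a : 'I_n) c x :
  (forall s, degle false (x s / c)) ->
  approx a c x (qKZ_operator kappa a x)
    (\sum_(j | j != a) (zvar K a - zvar K j)^-1 *: (x - swap_factors a j x)).
Proof.
move=> hx; pose G j := (zvar K a - zvar K j)^-1 *: (x - swap_factors a j x).
rewrite -[X in approx _ _ _ _ X]/(\sum_(j | j != a) G j).
have -> : \sum_(j | j != a) G j =
    (0 + \sum_(j <- rev (enum 'I_n) | (a < j)%N) G j)
    + \sum_(j <- rev (enum 'I_n) | (j < a)%N) G j.
  rewrite add0r !(perm_big (enum 'I_n) (permEl (perm_rev _))) !big_enum_cond /=.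
  rewrite (bigID (fun j : 'I_n => (a < j)%N)) /=; congr (_ + _).
    by apply: eq_bigl => j; rewrite -val_eqE /=; case: ltngtP.
  by apply: eq_bigl => j; rewrite -val_eqE /=; case: ltngtP.
rewrite /qKZ_operator /=.
apply: (approx_prod (b := kappa)) => //.
  by move=> j ja; rewrite -val_eqE gtn_eqF.
apply: (approx_prod (b := 0)) => //; last exact: approx_refl.
by move=> j ja; rewrite -val_eqE ltn_eqF // rconst0 subr0.
Qed.

End Operators.

(** * Coordinates on Sing and the KZ operators there *)

Section Sing.
Variables (F : fieldType) (n : nat).

Definition weight_index (i : 'I_n) : {ffun 'I_n -> 'I_2} :=
  [ffun k => if k == i then 1 else 0].

Lemma weight_index_inj : injective weight_index.
Proof.
move=> i j /ffunP /(_ i); rewrite !ffunE eqxx.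
by case: (eqVneq i j) => // _ /(congr1 val).
Qed.

Lemma weight_index_tperm (a j i : 'I_n) :
  [ffun k => weight_index i (tperm a j k)] = weight_index (tperm a j i).
Proof.
apply/ffunP => k; rewrite !ffunE.
by rewrite -(inj_eq (@perm_inj _ (tperm a j))) tpermK.
Qed.

Lemma in_Sing_coords (x : Ltensor F n) : in_Sing x ->
  \sum_i x (weight_index i) = 0 /\
  (forall s, x s != 0 -> exists i, s = weight_index i).
Proof.
move=> [c [-> c0]].
have E s : (\sum_i c i *: vbase F i) s = \sum_i c i * (s == weight_index i)%:R.
  by rewrite sum_ffunE; apply: eq_bigr => i _; rewrite !ffunE.
split.
  rewrite -[RHS]c0; apply: eq_bigr => i _.
  rewrite E (bigD1 i) //= eqxx mulr1 big1 ?addr0 // => j ji.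
  by rewrite (inj_eq weight_index_inj) eq_sym (negPf ji) mulr0.
move=> s; rewrite E => h.
suff /existsP[i /eqP ->] : [exists i, s == weight_index i].
  by exists i.
apply: contraNT h; rewrite negb_exists => /forallP h.
by rewrite big1 // => i _; rewrite (negPf (h i)) mulr0.
Qed.

(* Euler's identity for the KZ connection: the sum of the operators
   [z_a Omega_(a,j) / (z_a - z_j)] is scalar on Sing. *)
Lemma sum_KZ_Sing (z : 'I_n -> F) (x : Ltensor F n) (i : 'I_n) :
  injective z -> \sum_k x (weight_index k) = 0 ->
  \sum_a z a * (\sum_(j | j != a) (z a - z j)^-1 *:
    (x - swap_factors a j x)) (weight_index i) = n%:R * x (weight_index i).
Proof.
move=> z_inj x0; pose c k := x (weight_index k).
have E a : z a * (\sum_(j | j != a) (z a - z j)^-1 *: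
    (x - swap_factors a j x)) (weight_index i) =
    \sum_(j | j != a) z a / (z a - z j) * (c i - c (tperm a j i)).
  rewrite sum_ffunE mulr_sumr; apply: eq_bigr => j _.
  by rewrite !ffunE weight_index_tperm -mulrA.
rewrite (eq_bigr _ (fun a _ => E a)) (bigD1 i) //=.
(* For [a != i], the transposition of [a] and [j] moves [i] only when [j = i]. *)
have -> : \sum_(a | a != i) \sum_(j | j != a)
    z a / (z a - z j) * (c i - c (tperm a j i)) =
    \sum_(a | a != i) z a / (z a - z i) * (c i - c a).
  apply: eq_bigr => a ai; rewrite (bigD1 i) 1?eq_sym //= tpermR.
  rewrite big1 ?addr0 // => j /andP[ja ji].
  by rewrite tpermD ?subrr ?mulr0.
rewrite -big_split /=.
(* The terms of the pairs [(i, j)] and [(j, i)] combine through [z_i / (z_i - z_j) + z_j / (z_j -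
   z_i) = 1]. *)
rewrite (eq_bigr (fun j => c i - c j)) => [|j ji]; last first.
  rewrite tpermL -mulrDl -[X in X + _]opprK -mulrN -invrN opprB.
  rewrite -mulNr -mulrDl addrC divff ?mul1r // subr_eq0.
  by rewrite (inj_eq z_inj).
have -> : \sum_(j | j != i) (c i - c j) = \sum_j (c i - c j).
  by rewrite [RHS](bigD1 i) //= subrr add0r.
by rewrite sumrB x0 subr0 sumr_const card_ord mulr_natl.
Qed.

End Sing.

(** * Linear equations over the prime subfield *)

Lemma natr_eq_pchar (K : fieldType) (p : nat) : p \in [pchar K] ->
  forall d e : nat, d%:R = e%:R :> 'F_p -> d%:R = e%:R :> K.
Proof.
move=> hp d e /(congr1 (fun t : 'F_p => t : nat)).
rewrite !val_Fp_nat ?(pcharf_prime hp) // => h.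
have E k : k%:R = (k %% p)%:R :> K.
  by rewrite {1}(divn_eq k p) natrD natrM (pcharf0 hp) mulr0 add0r.
by rewrite E h -E.
Qed.

Lemma linear_prime_subfield (K : fieldType) (p : nat) (hp : p \in [pchar K])
    (m d e : nat) (k : K) : ~~ (p %| m)%N ->
  m%:R + (k *+ d - k *+ e) = 0 -> in_prime_subfield p k.
Proof.
move=> pm; rewrite -!(mulr_natr k) -mulrBr => E.
(* If [d] and [e] agreed modulo [p], the equation would force [m] to vanish in [K]. *)
have de : (d%:R - e%:R : 'F_p) != 0.
  apply: contraNneq pm => /subr0_eq /(natr_eq_pchar hp) de.
  by move: E; rewrite de subrr mulr0 addr0 (dvdn_pcharf hp) => ->.
pose c : 'F_p := - m%:R / (d%:R - e%:R); exists c.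
(* [c] solves the same equation over ['F_p]. Stated between natural numbers, it transfers to [K],
   where the solution is unique. *)
have : (m + (c : nat) * d)%N%:R = ((c : nat) * e)%N%:R :> 'F_p.
  rewrite natrD !natrM natr_Zp; apply/eqP; rewrite -subr_eq0 -addrA -mulrBr.
  by rewrite divfK // subrr.
move/(natr_eq_pchar hp); rewrite natrD !natrM => /eqP.
rewrite -subr_eq0 -addrA -mulrBr => /eqP E'.
have de' : (d%:R - e%:R : K) != 0.
  apply: contraNneq pm => de'; move: E.
  by rewrite de' mulr0 addr0 (dvdn_pcharf hp) => ->.
by apply: (mulIf de'); apply: (addrI m%:R); rewrite E E'.
Qed.

(** * Comparison of the two sides at a dominant coordinate *)

Lemma lezB_leqD (a b c d : nat) :
  (a%:Z - b%:Z <= c%:Z - d%:Z)%R -> (a + d <= c + b)%N.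
Proof. by lia. Qed.

Theorem theorem1p1 (K : fieldType) (p : nat) (hp : p \in [pchar K])
    (n : nat) (hn : (1 < n)%N) (hpn : ~~ (p %| n)%N)
    (kappa : K) (hkappa : ~ in_prime_subfield p kappa)
    (f : Ltensor (ratfun K n) n)
    (hV : in_Sing f) (hqKZ : qKZ_solution kappa f) :
  f = 0.
Proof.
have [sum0 supp] := in_Sing_coords hV.
apply/ffunP => s1; rewrite [RHS]ffunE; apply/eqP/negPn/negP => fs1.
pose deg s : int := (msize \n_(repr (f s)))%:Z - (msize \d_(repr (f s)))%:Z.
(* A nonzero coordinate of maximal degree serves as the scale [c] of the expansion: every ratio
   [f s / f s0] then has degree at most 0. *)
case: (Order.TotalTheory.arg_maxP (P := fun s => f s != 0) deg fs1) => s0 f0 max.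
have hf s : degle false (f s / f s0).
  have [->|fs] := eqVneq (f s) 0; first by rewrite mul0r; exact: degle0.
  have le : (deg s <= deg s0)%R by exact: max.
  apply: (degle_div f0).
  by move: le; rewrite /deg; exact: lezB_leqD.
have [i0 Es0] := supp s0 f0.
have z_inj : injective (@zvar K n).
  move=> a j E; apply/eqP/negPn/negP => aj.
  by have := zdiff_neq0 aj (0 : K); rewrite E rconst0 subrr subr0 eqxx.
have [d [e hshift]] := degle_ratfun_shift kappa f0.
have hK : degle true (\sum_a zvar K a *
    ((ratfun_shift a kappa (f s0) - f s0 - (\sum_(j | j != a)
       (zvar K a - zvar K j)^-1 *: (f - swap_factors a j f)) s0) / f s0)).
  apply: degle_sum => a _; have [_] := approx_qKZ kappa a hf s0.
  by rewrite -hqKZ ffunE.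
apply: hkappa; apply: (linear_prime_subfield hp hpn (d := d) (e := e)).
apply: (@degle_rconst_eq0 K n); rewrite rconstD rconst_nat.
set r := rconst n _ in hshift *.
(* Subtracting the two estimates leaves the KZ sum, which is [n%:R] on Sing, plus the constant [r]
   from Euler's identity. *)
suff -> : n%:R + r =
    (\sum_a zvar K a * ((ratfun_shift a kappa (f s0) - f s0) / f s0) + r)
    - \sum_a zvar K a * ((ratfun_shift a kappa (f s0) - f s0 - (\sum_(j | j != a)
       (zvar K a - zvar K j)^-1 *: (f - swap_factors a j f)) s0) / f s0).
  exact: degleB.
rewrite addrAC; congr (_ + _); rewrite -sumrB.
apply: (mulIf f0); rewrite Es0 -(sum_KZ_Sing i0 z_inj sum0) -Es0 mulr_suml.
apply: eq_bigr => a _.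
by rewrite -mulrBr -mulrBl subKr -mulrA divfK.
Qed.
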